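(* Let $\mathcal{B}$ be a bicategory. There is a bicategory $\Lambda\mathcal{B}$ in which (i) the 0-cells are the endomorphism 1-cells of $\mathcal{B}$; (ii) for endomorphism 1-cells $P\colon V\to V$ and $Q\colon W\to W$, the 1-cells $P\to Q$ are pairs $(M,\psi)$ where $M\colon V\to W$ is a dualizable 1-cell in $\mathcal{B}$ and $\psi$ is a 2-cell $P\odot M\Rightarrow M\odot Q$ in $\mathcal{B}$; (iii) the 2-cells $(M,\psi)\Rightarrow(M',\psi')$ between 1-cells $P\to Q$ are the isomorphism 2-cells $\beta\colon M\Rightarrow M'$ of $\mathcal{B}$ such that $\psi'\circ(\mathrm{id}_P\odot\beta)=(\beta\odot\mathrm{id}_Q)\circ\psi$ as 2-cells $P\odot M\Rightarrow M'\odot Q$.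
   Context: Composition of 1-cells in a bicategory is written diagrammatically: $M\colon A\to B$ and $N\colon B\to C$ give $M\odot N\colon A\to C$; unit 1-cells are $U_A$; the left and right unitors are $\ell\colon U_A\odot M\to M$ and $r\colon M\odot U_B\to M$. A 1-cell $M\colon A\to B$ is (right) dualizable if there is a 1-cell $M^*\colon B\to A$ and 2-cells $\eta\colon U_A\to M\odot M^*$, $\epsilon\colon M^*\odot M\to U_B$ satisfying the triangle identities. The structure on $\Lambda\mathcal{B}$: vertical composition of 2-cells, associator and unitors are those of $\mathcal{B}$. The composite of $(M,\beta)\colon P\to Q$ and $(N,\gamma)\colon Q\to T$ is $(M,\beta)\boxdot(N,\gamma)=(M\odot N,\ \beta\diamondsuit\gamma)$, where $\beta\diamondsuit\gamma$ is (suppressing associators) $P\odot M\odot N\xrightarrow{\beta\odot\mathrm{id}_N}M\odot Q\odot N\xrightarrow{\mathrm{id}_M\odot\gamma}M\odot N\odot T$. The unit 1-cell at $P\colon V\to V$ is $U_V$ together with the 2-cell $P\odot U_V\xrightarrow{r}P\xrightarrow{\ell^{-1}}U_V\odot P$. *)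

(* Defs.v *)
Set Implicit Arguments.
Unset Strict Implicit.
Unset Printing Implicit Defensive.

Declare Scope bicat_scope.
Delimit Scope bicat_scope with bicat.
Local Open Scope bicat_scope.

Reserved Notation "M ⊙ N" (at level 40, left associativity).
Reserved Notation "f ⊙₂ g" (at level 40, left associativity).
Reserved Notation "M ⇒ N" (at level 70, no associativity).
Reserved Notation "g ∘ f" (at level 45, left associativity).

(* 0-cells, 1-cells and 2-cells, with the composition (in diagrammatic order)
   and the units of 1-cells.  These come separately from the rest of a
   bicategory so that one can speak of a bicategory whose cells are given. *)
Record bicat_cells := BicatCells {
  ob : Type;
  hom : ob -> ob -> Type;
  cell : forall A B : ob, hom A B -> hom A B -> Type;
  U : forall A : ob, hom A A;
  comp1 : forall A B C : ob, hom A B -> hom B C -> hom A C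
}.

Arguments hom {_} _ _.
Arguments cell {_ A B} _ _.
Arguments U {_} _.
Arguments comp1 {_ A B C} _ _.

Notation "M ⊙ N" := (comp1 M N) : bicat_scope.
Notation "M ⇒ N" := (cell M N) : bicat_scope.

(* [vcomp f g] is "first f, then g"; it is displayed [g ∘ f].
   [hcomp f g], displayed [f ⊙₂ g], is in the diagrammatic order of ⊙. *)
Class bicat_on (G : bicat_cells) := BicatOn {
  id2 : forall {A B : ob G} (M : hom A B), M ⇒ M;
  vcomp : forall {A B : ob G} {M N P : hom A B},
    M ⇒ N -> N ⇒ P -> M ⇒ P
    where "g ∘ f" := (vcomp f g);
  hcomp : forall {A B C : ob G} {M M' : hom A B} {N N' : hom B C},
    M ⇒ M' -> N ⇒ N' -> M ⊙ N ⇒ M' ⊙ N'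
    where "f ⊙₂ g" := (hcomp f g);
  assoc : forall {A B C D : ob G} (M : hom A B) (N : hom B C) (P : hom C D),
    M ⊙ N ⊙ P ⇒ M ⊙ (N ⊙ P);
  assoc_inv : forall {A B C D : ob G} (M : hom A B) (N : hom B C) (P : hom C D),
    M ⊙ (N ⊙ P) ⇒ M ⊙ N ⊙ P;
  lunit : forall {A B : ob G} (M : hom A B), U A ⊙ M ⇒ M;
  lunit_inv : forall {A B : ob G} (M : hom A B), M ⇒ U A ⊙ M;
  runit : forall {A B : ob G} (M : hom A B), M ⊙ U B ⇒ M;
  runit_inv : forall {A B : ob G} (M : hom A B), M ⇒ M ⊙ U B;

  vcomp_id_l : forall (A B : ob G) (M N : hom A B) (f : M ⇒ N),
    f ∘ id2 M = f;
  vcomp_id_r : forall (A B : ob G) (M N : hom A B) (f : M ⇒ N),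
    id2 N ∘ f = f;
  vcomp_assoc : forall (A B : ob G) (M N P Q : hom A B)
    (f : M ⇒ N) (g : N ⇒ P) (h : P ⇒ Q),
    h ∘ (g ∘ f) = (h ∘ g) ∘ f;

  hcomp_id : forall (A B C : ob G) (M : hom A B) (N : hom B C),
    id2 M ⊙₂ id2 N = id2 (M ⊙ N);
  interchange : forall (A B C : ob G)
    (M M' M'' : hom A B) (N N' N'' : hom B C)
    (f : M ⇒ M') (f' : M' ⇒ M'') (g : N ⇒ N') (g' : N' ⇒ N''),
    (f' ∘ f) ⊙₂ (g' ∘ g) = (f' ⊙₂ g') ∘ (f ⊙₂ g);

  assoc_invK : forall (A B C D : ob G) (M : hom A B) (N : hom B C) (P : hom C D),
    assoc_inv M N P ∘ assoc M N P = id2 (M ⊙ N ⊙ P);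
  assocK : forall (A B C D : ob G) (M : hom A B) (N : hom B C) (P : hom C D),
    assoc M N P ∘ assoc_inv M N P = id2 (M ⊙ (N ⊙ P));
  lunit_invK : forall (A B : ob G) (M : hom A B),
    lunit_inv M ∘ lunit M = id2 (U A ⊙ M);
  lunitK : forall (A B : ob G) (M : hom A B),
    lunit M ∘ lunit_inv M = id2 M;
  runit_invK : forall (A B : ob G) (M : hom A B),
    runit_inv M ∘ runit M = id2 (M ⊙ U B);
  runitK : forall (A B : ob G) (M : hom A B),
    runit M ∘ runit_inv M = id2 M;

  assoc_nat : forall (A B C D : ob G) (M M' : hom A B) (N N' : hom B C)
    (P P' : hom C D) (f : M ⇒ M') (g : N ⇒ N') (h : P ⇒ P'),
    assoc M' N' P' ∘ ((f ⊙₂ g) ⊙₂ h) = (f ⊙₂ (g ⊙₂ h)) ∘ assoc M N P;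
  lunit_nat : forall (A B : ob G) (M M' : hom A B) (f : M ⇒ M'),
    lunit M' ∘ (id2 (U A) ⊙₂ f) = f ∘ lunit M;
  runit_nat : forall (A B : ob G) (M M' : hom A B) (f : M ⇒ M'),
    runit M' ∘ (f ⊙₂ id2 (U B)) = f ∘ runit M;

  pentagon : forall (A B C D E : ob G)
    (M : hom A B) (N : hom B C) (P : hom C D) (Q : hom D E),
    assoc M N (P ⊙ Q) ∘ assoc (M ⊙ N) P Q
    = (id2 M ⊙₂ assoc N P Q) ∘ assoc M (N ⊙ P) Q ∘ (assoc M N P ⊙₂ id2 Q);
  triangle : forall (A B C : ob G) (M : hom A B) (N : hom B C),
    (id2 M ⊙₂ lunit N) ∘ assoc M (U B) N = runit M ⊙₂ id2 N
}.

Notation "g ∘ f" := (vcomp f g) : bicat_scope.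
Notation "f ⊙₂ g" := (hcomp f g) : bicat_scope.

Record bicategory := Bicategory {
  cells :> bicat_cells;
  bicat_struct : bicat_on cells
}.

#[global] Existing Instance bicat_struct.

Section Lambda.

Variable B : bicategory.

Definition is_iso2 (V W : ob B) (M N : hom V W) (f : M ⇒ N) : Prop :=
  exists g : N ⇒ M, g ∘ f = id2 M /\ f ∘ g = id2 N.

Definition dualizable (V W : ob B) (M : hom V W) : Prop :=
  exists (D : hom W V) (eta : U V ⇒ M ⊙ D) (eps : D ⊙ M ⇒ U W),
    runit M ∘ (id2 M ⊙₂ eps) ∘ assoc M D M ∘ (eta ⊙₂ id2 M) ∘ lunit_inv M
      = id2 M
    /\ lunit D ∘ (eps ⊙₂ id2 D) ∘ assoc_inv D M D ∘ (id2 D ⊙₂ eta) ∘ runit_inv D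
      = id2 D.

Record endo1 := Endo1 {
  endo_ob : ob B;
  endo_mor :> hom endo_ob endo_ob
}.

Record lambda1 (P Q : endo1) := Lambda1 {
  mor1 :> hom (endo_ob P) (endo_ob Q);
  twist : endo_mor P ⊙ mor1 ⇒ mor1 ⊙ endo_mor Q;
  mor1_dual : dualizable mor1
}.

Record lambda2 (P Q : endo1) (m m' : lambda1 P Q) := Lambda2 {
  mor2 : mor1 m ⇒ mor1 m';
  mor2_iso : is_iso2 mor2;
  mor2_twist :
    twist m' ∘ (id2 (endo_mor P) ⊙₂ mor2) = (mor2 ⊙₂ id2 (endo_mor Q)) ∘ twist m
}.

Definition twist_unit (P : endo1) :
    endo_mor P ⊙ U (endo_ob P) ⇒ U (endo_ob P) ⊙ endo_mor P :=
  lunit_inv P ∘ runit P.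

(* β ◇ γ *)
Definition twist_comp (P Q T : endo1) (m : lambda1 P Q) (n : lambda1 Q T) :
    endo_mor P ⊙ (mor1 m ⊙ mor1 n) ⇒ (mor1 m ⊙ mor1 n) ⊙ endo_mor T :=
  assoc_inv m n T
  ∘ (id2 (mor1 m) ⊙₂ twist n)
  ∘ assoc m Q n
  ∘ (twist m ⊙₂ id2 (mor1 n))
  ∘ assoc_inv P m n.

(* The closure of dualizable 1-cells under units and composition is needed to
   form the units and the composites below, hence the two arguments. *)
Definition lambda_cells
    (dual_U : forall V : ob B, dualizable (U V))
    (dual_comp : forall (V W X : ob B) (M : hom V W) (N : hom W X),
       dualizable M -> dualizable N -> dualizable (M ⊙ N)) : bicat_cells :=
  {| ob := endo1;
     hom := lambda1;
     cell := lambda2;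
     U := fun P => Lambda1 (twist_unit P) (dual_U (endo_ob P));
     comp1 := fun P Q T m n =>
       Lambda1 (twist_comp m n) (dual_comp _ _ _ _ _ (mor1_dual m) (mor1_dual n))
  |}.

End Lambda.

(* Main.v *)
(* Each 1-cell M : V -> W acts on the 1-cells into V by K |-> K ⊙ M, and a
   composite acts by composing actions, so that bracketings disappear.  Through
   the coherent isomorphisms K ⊙ M => act0 M K, a 2-cell f : M => N becomes a
   natural transformation [hat f].  This passage is faithful and compatible with
   both compositions, and it sends associators and unitors to identities (by
   the pentagon, the triangle and Kelly's identity for the right unitor).  Every
   equation needed below thus reduces to one in a strict 2-category, where it
   is the composition of adjunctions or the pasting of commuting squares. *)

Require Import Defs.
From Stdlib Require Import ProofIrrelevance.
Local Open Scope bicat_scope.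

Set Implicit Arguments.
Unset Strict Implicit.
Unset Printing Implicit Defensive.

Section Strictification.

Context {B : bicategory}.

(** * Cancellation, whiskering and Kelly's unitor identity *)

Lemma cell_split_mono (V W : ob B) (M N P : hom V W) (f g : M ⇒ N)
  (k : N ⇒ P) (k' : P ⇒ N) :
  k' ∘ k = id2 N -> k ∘ f = k ∘ g -> f = g.
Proof.
intros hk e.
rewrite <- (vcomp_id_r f), <- (vcomp_id_r g), <- hk, <- !vcomp_assoc.
now rewrite e.
Qed.

Lemma cell_split_epi (V W : ob B) (M N P : hom V W) (f g : N ⇒ P)
  (k : M ⇒ N) (k' : N ⇒ M) :
  k ∘ k' = id2 N -> f ∘ k = g ∘ k -> f = g.
Proof.
intros hk e.
rewrite <- (vcomp_id_l f), <- (vcomp_id_l g), <- hk, !vcomp_assoc.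
now rewrite e.
Qed.

Lemma whiskerl_vcomp (V W X : ob B) (M : hom V W) (N N' N'' : hom W X)
  (f : N ⇒ N') (g : N' ⇒ N'') :
  id2 M ⊙₂ (g ∘ f) = (id2 M ⊙₂ g) ∘ (id2 M ⊙₂ f).
Proof. now rewrite <- interchange, vcomp_id_l. Qed.

Lemma whiskerr_vcomp (V W X : ob B) (M M' M'' : hom V W) (N : hom W X)
  (f : M ⇒ M') (g : M' ⇒ M'') :
  (g ∘ f) ⊙₂ id2 N = (g ⊙₂ id2 N) ∘ (f ⊙₂ id2 N).
Proof. now rewrite <- interchange, vcomp_id_l. Qed.

Lemma whisker_swap (V W X : ob B) (M M' : hom V W) (N N' : hom W X)
  (f : M ⇒ M') (g : N ⇒ N') :
  (f ⊙₂ id2 N') ∘ (id2 M ⊙₂ g) = (id2 M' ⊙₂ g) ∘ (f ⊙₂ id2 N).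
Proof. now rewrite <- !interchange, !vcomp_id_l, !vcomp_id_r. Qed.

Lemma whiskerl_unit_inj (V W : ob B) (M N : hom V W) (f g : M ⇒ N) :
  id2 (U V) ⊙₂ f = id2 (U V) ⊙₂ g -> f = g.
Proof.
intros e; apply (cell_split_epi (lunitK M)).
now rewrite <- !lunit_nat, e.
Qed.

Lemma whiskerr_unit_inj (V W : ob B) (M N : hom V W) (f g : M ⇒ N) :
  f ⊙₂ id2 (U W) = g ⊙₂ id2 (U W) -> f = g.
Proof.
intros e; apply (cell_split_epi (runitK M)).
now rewrite <- !runit_nat, e.
Qed.

Lemma assoc_inv_nat (V W X Y : ob B) (M M' : hom V W) (N N' : hom W X)
    (P P' : hom X Y) (f : M ⇒ M') (g : N ⇒ N') (h : P ⇒ P') :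
  assoc_inv M' N' P' ∘ (f ⊙₂ (g ⊙₂ h)) = ((f ⊙₂ g) ⊙₂ h) ∘ assoc_inv M N P.
Proof.
apply (cell_split_mono (assoc_invK M' N' P')).
rewrite !vcomp_assoc, assoc_nat, assocK, vcomp_id_r.
now rewrite <- vcomp_assoc, assocK, vcomp_id_l.
Qed.

(* Kelly's argument: it is enough to compare the two sides after - ⊙ U X. *)
Lemma runit_comp (V W X : ob B) (M : hom V W) (N : hom W X) :
  (id2 M ⊙₂ runit N) ∘ assoc M N (U X) = runit (M ⊙ N).
Proof.
apply whiskerr_unit_inj; rewrite whiskerr_vcomp.
apply (cell_split_mono (assoc_invK M N (U X))).
(* The triangle turns both right unitors into whiskerings of [lunit (U X)], and the pentagon then
   matches the associators. *)
rewrite vcomp_assoc, assoc_nat, <- !triangle, whiskerl_vcomp.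
rewrite <- (vcomp_assoc (assoc _ _ _)), <- !(vcomp_assoc (_ ⊙₂ id2 _)).
rewrite (vcomp_assoc (_ ⊙₂ id2 _) _ (id2 M ⊙₂ assoc _ _ _)), <- pentagon.
now rewrite !vcomp_assoc, <- hcomp_id, assoc_nat.
Qed.

(* A representation of the action of M is a choice of functors isomorphic to
   (- ⊙ M); the instances for ⊙ and U make [act0 (M ⊙ N) K] and
   [act0 (U V) K] compute to [act0 N (act0 M K)] and [K]. *)
Class rep {V W : ob B} (M : hom V W) := Rep {
  act0 : forall {Z : ob B}, hom Z V -> hom Z W;
  act : forall {Z : ob B} {K L : hom Z V}, K ⇒ L -> act0 K ⇒ act0 L;
  act_iso : forall {Z : ob B} (K : hom Z V), K ⊙ M ⇒ act0 K;
  act_iso_inv : forall {Z : ob B} (K : hom Z V), act0 K ⇒ K ⊙ M;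
  act_id2 : forall (Z : ob B) (K : hom Z V), act (id2 K) = id2 (act0 K);
  act_vcomp : forall (Z : ob B) (K L J : hom Z V) (k : K ⇒ L) (l : L ⇒ J),
    act (l ∘ k) = act l ∘ act k;
  act_iso_nat : forall (Z : ob B) (K L : hom Z V) (k : K ⇒ L),
    act_iso L ∘ (k ⊙₂ id2 M) = act k ∘ act_iso K;
  act_isoK : forall (Z : ob B) (K : hom Z V),
    act_iso K ∘ act_iso_inv K = id2 (act0 K);
  act_iso_invK : forall (Z : ob B) (K : hom Z V),
    act_iso_inv K ∘ act_iso K = id2 (K ⊙ M)
}.

Arguments act0 {V W} M {rep Z} _.
Arguments act {V W} M {rep Z K L} _.
Arguments act_iso {V W} M {rep Z} _.
Arguments act_iso_inv {V W} M {rep Z} _.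

(** * Representations of composites, units and atomic 1-cells *)

#[local] Instance rep_comp {V W X : ob B} (M : hom V W) (N : hom W X)
  (rM : rep M) (rN : rep N) : rep (M ⊙ N) | 1.
Proof.
refine {|
  act0 Z K := act0 N (act0 M K);
  act Z K L k := act N (act M k);
  act_iso Z K := act_iso N (act0 M K) ∘ (act_iso M K ⊙₂ id2 N)
                 ∘ assoc_inv K M N;
  act_iso_inv Z K := assoc K M N ∘ (act_iso_inv M K ⊙₂ id2 N)
                     ∘ act_iso_inv N (act0 M K) |}.
- intros; now rewrite !act_id2.
- intros; now rewrite !act_vcomp.
- intros.
  rewrite <- vcomp_assoc, <- hcomp_id, assoc_inv_nat, !vcomp_assoc.
  f_equal; rewrite <- !vcomp_assoc, <- whiskerr_vcomp, (act_iso_nat (M := M)).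
  now rewrite whiskerr_vcomp, !vcomp_assoc, act_iso_nat.
- intros; rewrite !vcomp_assoc, <- (vcomp_assoc (assoc _ _ _)), assoc_invK.
  rewrite vcomp_id_l, <- (vcomp_assoc (act_iso_inv M K ⊙₂ _)).
  now rewrite <- whiskerr_vcomp, act_isoK, hcomp_id, vcomp_id_l, act_isoK.
- intros; rewrite !vcomp_assoc, <- (vcomp_assoc (act_iso N _)), act_iso_invK.
  rewrite vcomp_id_l, <- (vcomp_assoc (act_iso M _ ⊙₂ _)).
  now rewrite <- whiskerr_vcomp, act_iso_invK, hcomp_id, vcomp_id_l, assocK.
Defined.

#[local] Instance rep_unit (V : ob B) : rep (U V) | 1.
Proof.
refine {|
  act0 Z K := K; act Z K L k := k;
  act_iso Z K := runit K; act_iso_inv Z K := runit_inv K |}.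
- reflexivity.
- reflexivity.
- intros; apply runit_nat.
- intros; apply runitK.
- intros; apply runit_invK.
Defined.

(** Fallback for atomic 1-cells: the weaker priority lets composites and units be decomposed
    first. *)
#[local] Instance rep_whisker (V W : ob B) (M : hom V W) : rep M | 10.
Proof.
refine {|
  act0 Z K := K ⊙ M; act Z K L k := k ⊙₂ id2 M;
  act_iso Z K := id2 (K ⊙ M); act_iso_inv Z K := id2 (K ⊙ M) |}.
- intros; apply hcomp_id.
- intros; apply whiskerr_vcomp.
- intros; now rewrite vcomp_id_l, vcomp_id_r.
- intros; apply vcomp_id_l.
- intros; apply vcomp_id_l.
Defined.

(** * 2-cells as natural transformations between actions *)

Definition hat {V W : ob B} {M N : hom V W} {rM : rep M} {rN : rep N}
    (f : M ⇒ N) {Z : ob B} (K : hom Z V) : act0 M K ⇒ act0 N K :=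
  act_iso N K ∘ (id2 K ⊙₂ f) ∘ act_iso_inv M K.

(** The component at [U V] already determines [f]: there [hat f] is [id2 (U V) ⊙₂ f] up to
    composition with isomorphisms. *)
Lemma hat_inj (V W : ob B) (M N : hom V W) {rM : rep M} {rN : rep N}
    (f g : M ⇒ N) :
  (forall (Z : ob B) (K : hom Z V), hat f K = hat g K) -> f = g.
Proof.
intros e; apply whiskerl_unit_inj.
apply (cell_split_mono (act_iso_invK (M := N) (U V))).
apply (cell_split_epi (act_iso_invK (M := M) (U V))).
apply e.
Qed.

Lemma hatP (V W : ob B) (M N : hom V W) {rM : rep M} {rN : rep N}
    (f : M ⇒ N) (Z : ob B) (K : hom Z V) (h : act0 M K ⇒ act0 N K) :
  act_iso N K ∘ (id2 K ⊙₂ f) = h ∘ act_iso M K -> hat f K = h.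
Proof.
intros e; unfold hat.
now rewrite e, <- vcomp_assoc, act_isoK, vcomp_id_l.
Qed.

Lemma act_iso_hat (V W : ob B) (M N : hom V W) {rM : rep M} {rN : rep N}
    (f : M ⇒ N) (Z : ob B) (K : hom Z V) :
  act_iso N K ∘ (id2 K ⊙₂ f) = hat f K ∘ act_iso M K.
Proof.
unfold hat; now rewrite <- vcomp_assoc, act_iso_invK, vcomp_id_l.
Qed.

Lemma hat_id2 (V W : ob B) (M : hom V W) {rM : rep M}
    (Z : ob B) (K : hom Z V) :
  hat (id2 M) K = id2 (act0 M K).
Proof. now apply hatP; rewrite hcomp_id, vcomp_id_l, vcomp_id_r. Qed.

Lemma hat_vcomp (V W : ob B) (M N P : hom V W)
    {rM : rep M} {rN : rep N} {rP : rep P}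
    (f : M ⇒ N) (g : N ⇒ P) (Z : ob B) (K : hom Z V) :
  hat (g ∘ f) K = hat g K ∘ hat f K.
Proof.
apply hatP; rewrite whiskerl_vcomp, vcomp_assoc, (act_iso_hat g).
now rewrite <- vcomp_assoc, (act_iso_hat f), vcomp_assoc.
Qed.

(** Interchange of [k] with [f], transported along the isomorphisms [act_iso]. *)
Lemma hat_nat (V W : ob B) (M N : hom V W) {rM : rep M} {rN : rep N}
    (f : M ⇒ N) (Z : ob B) (K L : hom Z V) (k : K ⇒ L) :
  hat f L ∘ act M k = act N k ∘ hat f K.
Proof.
apply (cell_split_epi (act_isoK (M := M) K)).
rewrite <- vcomp_assoc, <- act_iso_nat, vcomp_assoc, <- act_iso_hat.
rewrite <- vcomp_assoc, <- whisker_swap, vcomp_assoc, act_iso_nat.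
now rewrite <- !vcomp_assoc, (act_iso_hat f).
Qed.

Lemma hat_hcomp (V W X : ob B) (M M' : hom V W) (N N' : hom W X)
    {rM : rep M} {rM' : rep M'} {rN : rep N} {rN' : rep N'}
    (f : M ⇒ M') (g : N ⇒ N') (Z : ob B) (K : hom Z V) :
  hat (f ⊙₂ g) K = act N' (hat f K) ∘ hat g (act0 M K).
Proof.
apply hatP; cbn.
rewrite <- vcomp_assoc, assoc_inv_nat, !vcomp_assoc; f_equal.
rewrite <- (vcomp_assoc _ _ (act N' _)), <- act_iso_hat, vcomp_assoc.
rewrite <- (act_iso_nat (M := N')), <- !vcomp_assoc; f_equal.
now rewrite <- !interchange, !vcomp_id_l, !vcomp_id_r, (act_iso_hat f).
Qed.

(** [U V ⊙ M] and [M] act by convertible functors, so the right side is well typed; the equation is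
    the triangle for [K], [U V], [M]. *)
Lemma hat_lunit (V W : ob B) (M : hom V W) {rM : rep M}
    (Z : ob B) (K : hom Z V) :
  hat (lunit M) K = id2 (act0 M K).
Proof.
apply hatP; rewrite vcomp_id_r; cbn.
apply (cell_split_epi (assocK K (U V) M)).
rewrite <- !vcomp_assoc, triangle, assoc_invK.
now rewrite vcomp_id_l.
Qed.

Lemma hat_runit (V W : ob B) (M : hom V W) {rM : rep M}
    (Z : ob B) (K : hom Z V) :
  hat (runit M) K = id2 (act0 M K).
Proof.
apply hatP; rewrite vcomp_id_r; cbn.
apply (cell_split_epi (assocK K M (U W))).
rewrite <- !vcomp_assoc, runit_comp, assoc_invK, vcomp_id_l.
now rewrite runit_nat.
Qed.

Lemma hat_assoc (V W X Y : ob B) (M : hom V W) (N : hom W X) (P : hom X Y)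
    {rM : rep M} {rN : rep N} {rP : rep P} (Z : ob B) (K : hom Z V) :
  hat (assoc M N P) K = id2 (act0 P (act0 N (act0 M K))).
Proof.
apply hatP; cbn; rewrite vcomp_id_r.
(* Precomposing with [assoc K (M ⊙ N) P], then with [assoc K M N ⊙₂ id2 P], completes
   [id2 K ⊙₂ assoc M N P] to the three-factor side of the pentagon. *)
apply (cell_split_epi (assocK K (M ⊙ N) P)).
rewrite <- !vcomp_assoc, assoc_invK, vcomp_id_l; f_equal.
apply (@cell_split_epi _ _ _ _ _ _ _ (assoc K M N ⊙₂ id2 P)
         (assoc_inv K M N ⊙₂ id2 P)).
{ now rewrite <- whiskerr_vcomp, assocK, hcomp_id. }
rewrite !whiskerr_vcomp, <- !vcomp_assoc, <- whiskerr_vcomp.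
rewrite assoc_invK, hcomp_id, vcomp_id_l.
rewrite (vcomp_assoc _ _ (id2 K ⊙₂ _)), <- pentagon.
rewrite (vcomp_assoc (assoc _ _ _)), assoc_invK, vcomp_id_r.
rewrite <- hcomp_id, <- assoc_nat, (vcomp_assoc _ _ (assoc_inv _ _ _)).
now rewrite assoc_invK, vcomp_id_r.
Qed.

Lemma hat_inverse (V W : ob B) (M N : hom V W) {rM : rep M} {rN : rep N}
    (f : M ⇒ N) (g : N ⇒ M) (Z : ob B) (K : hom Z V) :
  f ∘ g = id2 N -> hat f K ∘ hat g K = id2 (act0 N K).
Proof. now intros e; rewrite <- hat_vcomp, e, hat_id2. Qed.

Lemma hat_lunit_inv (V W : ob B) (M : hom V W) {rM : rep M}
    (Z : ob B) (K : hom Z V) :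
  hat (lunit_inv M) K = id2 (act0 M K).
Proof.
rewrite <- (hat_inverse K (lunitK M)), hat_lunit; cbn.
now rewrite vcomp_id_r.
Qed.

Lemma hat_runit_inv (V W : ob B) (M : hom V W) {rM : rep M}
    (Z : ob B) (K : hom Z V) :
  hat (runit_inv M) K = id2 (act0 M K).
Proof.
rewrite <- (hat_inverse K (runitK M)), hat_runit; cbn.
now rewrite vcomp_id_r.
Qed.

Lemma hat_assoc_inv (V W X Y : ob B) (M : hom V W) (N : hom W X) (P : hom X Y)
    {rM : rep M} {rN : rep N} {rP : rep P} (Z : ob B) (K : hom Z V) :
  hat (assoc_inv M N P) K = id2 (act0 P (act0 N (act0 M K))).
Proof.
pose proof (hat_inverse K (assocK M N P)) as e.
rewrite hat_assoc in e; cbn in e.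
now rewrite vcomp_id_r in e.
Qed.

(* The intermediate [rep] of a vertical composite does not occur in the goal,
   so it has to be inferred from the explicit factors. *)
Ltac hat_simpl :=
  repeat (first
    [ match goal with
      | |- context [hat (?g ∘ ?f) _] => rewrite (hat_vcomp f g)
      end
    | rewrite hat_hcomp | rewrite hat_id2
    | rewrite hat_lunit | rewrite hat_lunit_inv
    | rewrite hat_runit | rewrite hat_runit_inv
    | rewrite hat_assoc | rewrite hat_assoc_inv
    | rewrite act_id2 | rewrite hcomp_id
    | rewrite vcomp_id_l | rewrite vcomp_id_r ]; cbn).

(** * Dualizable 1-cells: units and composites *)

(** Associators and unitors act as identities, so what survives is a triangle identity of an
    ordinary adjunction: [act0 M] is left adjoint to [act0 D], with unit [hat eta] and counit
    [hat eps]. Faithfulness of [hat] gives the converse. *)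
Lemma zigzag_hat (V W : ob B) (M : hom V W) (D : hom W V)
    {rM : rep M} {rD : rep D} (eta : U V ⇒ M ⊙ D) (eps : D ⊙ M ⇒ U W) :
  runit M ∘ (id2 M ⊙₂ eps) ∘ assoc M D M ∘ (eta ⊙₂ id2 M) ∘ lunit_inv M = id2 M
  <-> forall (Z : ob B) (K : hom Z V),
        hat eps (act0 M K) ∘ act M (hat eta K) = id2 (act0 M K).
Proof.
assert (e : forall (Z : ob B) (K : hom Z V),
  hat (runit M ∘ (id2 M ⊙₂ eps) ∘ assoc M D M ∘ (eta ⊙₂ id2 M) ∘ lunit_inv M) K
  = hat eps (act0 M K) ∘ act M (hat eta K)).
{ now intros Z K; hat_simpl. }
split.
- now intros h Z K; rewrite <- e, h, hat_id2.
- intros h; apply (hat_inj (M := M) (N := M)); intros Z K.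
  now rewrite e, h, hat_id2.
Qed.

Lemma zagzig_hat (V W : ob B) (M : hom V W) (D : hom W V)
    {rM : rep M} {rD : rep D} (eta : U V ⇒ M ⊙ D) (eps : D ⊙ M ⇒ U W) :
  lunit D ∘ (eps ⊙₂ id2 D) ∘ assoc_inv D M D ∘ (id2 D ⊙₂ eta) ∘ runit_inv D = id2 D
  <-> forall (Z : ob B) (K : hom Z W),
        act D (hat eps K) ∘ hat eta (act0 D K) = id2 (act0 D K).
Proof.
assert (e : forall (Z : ob B) (K : hom Z W),
  hat (lunit D ∘ (eps ⊙₂ id2 D) ∘ assoc_inv D M D ∘ (id2 D ⊙₂ eta) ∘ runit_inv D) K
  = act D (hat eps K) ∘ hat eta (act0 D K)).
{ now intros Z K; hat_simpl. }
split.
- now intros h Z K; rewrite <- e, h, hat_id2.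
- intros h; apply (hat_inj (M := D) (N := D)); intros Z K.
  now rewrite e, h, hat_id2.
Qed.

Lemma dualizable_unit (V : ob B) : dualizable (U V).
Proof.
exists (U V), (lunit_inv (U V)), (lunit (U V)); split.
- apply (proj2 (zigzag_hat (lunit_inv (U V)) (lunit (U V)))); intros Z K.
  now hat_simpl.
- apply (proj2 (zagzig_hat (lunit_inv (U V)) (lunit (U V)))); intros Z K.
  now hat_simpl.
Qed.

Lemma dualizable_comp (V W X : ob B) (M : hom V W) (N : hom W X) :
  dualizable M -> dualizable N -> dualizable (M ⊙ N).
Proof.
intros (D & eta & eps & zig & zag) (E & eta' & eps' & zig' & zag').
(* The new unit inserts [eta'] between the factors [M] and [D] produced by [eta]; the new counit
   contracts [D ⊙ M] by [eps] before applying [eps']. *)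
pose (eta'' := assoc_inv M N (E ⊙ D)
   ∘ (id2 M ⊙₂ (assoc N E D ∘ (eta' ⊙₂ id2 D) ∘ lunit_inv D)) ∘ eta).
pose (eps'' := eps' ∘ (id2 E ⊙₂ (lunit N ∘ (eps ⊙₂ id2 N) ∘ assoc_inv D M N))
   ∘ assoc E D (M ⊙ N)).
exists (E ⊙ D), eta'', eps''.
pose proof (proj1 (zigzag_hat eta eps) zig) as hzig.
pose proof (proj1 (zagzig_hat eta eps) zag) as hzag.
pose proof (proj1 (zigzag_hat eta' eps') zig') as hzig'.
pose proof (proj1 (zagzig_hat eta' eps') zag') as hzag'.
cbn in *.
split.
- apply (proj2 (zigzag_hat eta'' eps'')); intros Z K.
  unfold eta'', eps''; hat_simpl.
  rewrite <- vcomp_assoc, <- whiskerr_vcomp.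
  rewrite (whiskerr_vcomp M), vcomp_assoc.
  (* Naturality slides [eps] past [eta']; the zigzag of [M] contracts, leaving that of [N]. *)
  pose proof (hat_nat eps (hat eta' (K ⊙ M))) as nat; cbn in nat.
  rewrite nat, <- vcomp_assoc, hzig, vcomp_id_l.
  apply hzig'.
- apply (proj2 (zagzig_hat eta'' eps'')); intros Z K.
  unfold eta'', eps''; hat_simpl.
  rewrite vcomp_assoc, <- whiskerr_vcomp.
  rewrite (whiskerr_vcomp E), <- (vcomp_assoc _ _ (_ ⊙₂ id2 E)).
  (* The same slide in the other direction: now the zigzag of [N] contracts first. *)
  pose proof (hat_nat eta' (hat eps (K ⊙ E))) as nat; cbn in nat.
  rewrite <- nat, vcomp_assoc, hzag', vcomp_id_r.
  apply hzag.
Qed.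

(** * The bicategory structure on [ΛB] *)

Notation ΛB := (lambda_cells dualizable_unit dualizable_comp).

(** The remaining fields are proofs of propositions, identified by proof irrelevance. Each law of
    [ΛB] thereby reduces to the same law in [B]. *)
Lemma lambda2_eq (P Q : ob ΛB) (m n : hom P Q) (f g : m ⇒ n) :
  mor2 f = mor2 g -> f = g.
Proof.
destruct f as [f hf tf], g as [g hg tg]; cbn; intros e; subst g.
now rewrite (proof_irrelevance _ hf hg), (proof_irrelevance _ tf tg).
Qed.

(** Inverting a 2-cell that respects the twists gives one that respects them too; this lifts the
    inverse associators and unitors to [ΛB]. *)
Definition lambda2_inv (P Q : ob ΛB) (m n : hom P Q) (f : m ⇒ n)
  (g : mor1 n ⇒ mor1 m)
  (gf : g ∘ mor2 f = id2 (mor1 m)) (fg : mor2 f ∘ g = id2 (mor1 n)) : n ⇒ m.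
Proof.
exists g.
- now exists (mor2 f).
- apply (@cell_split_mono _ _ _ _ _ _ _ (mor2 f ⊙₂ id2 _) (g ⊙₂ id2 _)).
  { now rewrite <- whiskerr_vcomp, gf, hcomp_id. }
  rewrite !vcomp_assoc, <- (mor2_twist f), <- whiskerr_vcomp, fg.
  rewrite hcomp_id, vcomp_id_r, <- vcomp_assoc, <- whiskerl_vcomp, fg.
  now rewrite hcomp_id, vcomp_id_l.
Defined.

Definition lambda_id2 (P Q : ob ΛB) (m : hom P Q) : m ⇒ m.
Proof.
exists (id2 (mor1 m)).
- exists (id2 _); now rewrite vcomp_id_l.
- now rewrite !hcomp_id, vcomp_id_l, vcomp_id_r.
Defined.

Definition lambda_vcomp (P Q : ob ΛB) (m n p : hom P Q)
  (f : m ⇒ n) (g : n ⇒ p) : m ⇒ p.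
Proof.
exists (mor2 g ∘ mor2 f).
- destruct (mor2_iso f) as (f' & ff & ff'), (mor2_iso g) as (g' & gg & gg').
  exists (f' ∘ g'); split.
  + now rewrite vcomp_assoc, <- (vcomp_assoc (mor2 g)), gg, vcomp_id_l.
  + now rewrite vcomp_assoc, <- (vcomp_assoc f'), ff', vcomp_id_l.
- rewrite whiskerl_vcomp, whiskerr_vcomp, vcomp_assoc, mor2_twist.
  now rewrite <- !vcomp_assoc, mor2_twist.
Defined.

Lemma hat_twist (P Q : ob ΛB) (m n : hom P Q) (f : m ⇒ n)
    (Z : ob B) (K : hom Z (endo_ob P)) :
  hat (twist n) K ∘ hat (mor2 f) (K ⊙ endo_mor P)
  = (hat (mor2 f) K ⊙₂ id2 (endo_mor Q)) ∘ hat (twist m) K.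
Proof.
assert (e : hat (twist n ∘ (id2 (endo_mor P) ⊙₂ mor2 f)) K
            = hat ((mor2 f ⊙₂ id2 (endo_mor Q)) ∘ twist m) K).
{ now rewrite mor2_twist. }
revert e; hat_simpl; trivial.
Qed.

Definition lambda_hcomp (P Q T : ob ΛB) (m m' : hom P Q) (n n' : hom Q T)
  (f : m ⇒ m') (g : n ⇒ n') : m ⊙ n ⇒ m' ⊙ n'.
Proof.
exists (mor2 f ⊙₂ mor2 g).
- destruct (mor2_iso f) as (f' & ff & ff'), (mor2_iso g) as (g' & gg & gg').
  exists (f' ⊙₂ g').
  split; cbn; rewrite <- interchange, ?ff, ?ff', ?gg, ?gg'; apply hcomp_id.
- cbn; refine (hat_inj _); intros Z K; unfold twist_comp; hat_simpl.
  (* The required square is pasted from four: those of [f] and [g], and the naturality of [mor2 g]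
     against [twist m] and of [twist n'] against [mor2 f]. *)
  pose proof (hat_nat (mor2 g) (hat (twist m) K)) as natg.
  pose proof (hat_nat (twist n') (hat (mor2 f) K)) as natn.
  pose proof (hat_twist f K) as twf.
  pose proof (hat_twist g (K ⊙ mor1 m)) as twg.
  cbn in natg, natn, twf, twg.
  rewrite <- vcomp_assoc, (vcomp_assoc _ _ (_ ⊙₂ id2 (mor1 n'))).
  rewrite <- whiskerr_vcomp.
  rewrite twf, whiskerr_vcomp, <- vcomp_assoc, <- natg.
  rewrite vcomp_assoc, natn, whiskerr_vcomp, <- !vcomp_assoc; f_equal.
  now rewrite !vcomp_assoc, twg.
Defined.

Definition lambda_assoc (P Q T S : ob ΛB)
  (m : hom P Q) (n : hom Q T) (p : hom T S) :
  m ⊙ n ⊙ p ⇒ m ⊙ (n ⊙ p).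
Proof.
exists (assoc (mor1 m) (mor1 n) (mor1 p)).
- exists (assoc_inv (mor1 m) (mor1 n) (mor1 p)); split.
  + apply assoc_invK.
  + apply assocK.
(* With associators acting as identities, both bracketings give the same pasting of the twists of
   [m], [n] and [p]. *)
- cbn; refine (hat_inj _); intros Z K.
  unfold twist_comp; cbn; unfold twist_comp; hat_simpl.
  now rewrite whiskerr_vcomp, vcomp_assoc.
Defined.

Definition lambda_lunit (P Q : ob ΛB) (m : hom P Q) : U P ⊙ m ⇒ m.
Proof.
exists (lunit (mor1 m)).
- exists (lunit_inv (mor1 m)); split.
  + apply lunit_invK.
  + apply lunitK.
(* [twist_unit] is a composite of unitors and hence acts as an identity. *)
- cbn; refine (hat_inj _); intros Z K.
  unfold twist_comp; cbn; unfold twist_unit; now hat_simpl.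
Defined.

Definition lambda_runit (P Q : ob ΛB) (m : hom P Q) : m ⊙ U Q ⇒ m.
Proof.
exists (runit (mor1 m)).
- exists (runit_inv (mor1 m)); split.
  + apply runit_invK.
  + apply runitK.
- cbn; refine (hat_inj _); intros Z K.
  unfold twist_comp; cbn; unfold twist_unit; now hat_simpl.
Defined.

Definition lambda_bicat : bicat_on ΛB.
Proof.
refine (@BicatOn ΛB lambda_id2 lambda_vcomp lambda_hcomp lambda_assoc
  (fun _ _ _ _ m n p => lambda2_inv (f := lambda_assoc m n p)
     (assoc_invK (mor1 m) (mor1 n) (mor1 p)) (assocK (mor1 m) (mor1 n) (mor1 p)))
  lambda_lunit
  (fun _ _ m => lambda2_inv (f := lambda_lunit m)
     (lunit_invK (mor1 m)) (lunitK (mor1 m)))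
  lambda_runit
  (fun _ _ m => lambda2_inv (f := lambda_runit m)
     (runit_invK (mor1 m)) (runitK (mor1 m)))
  _ _ _ _ _ _ _ _ _ _ _ _ _ _ _ _);
  intros; apply lambda2_eq; cbn.
- apply vcomp_id_l.
- apply vcomp_id_r.
- apply vcomp_assoc.
- apply hcomp_id.
- apply interchange.
- apply assoc_invK.
- apply assocK.
- apply lunit_invK.
- apply lunitK.
- apply runit_invK.
- apply runitK.
- apply assoc_nat.
- apply lunit_nat.
- apply runit_nat.
- apply pentagon.
- apply triangle.
Defined.

End Strictification.

Theorem theorem4p1 (B : bicategory) :
  exists (dual_U : forall V : ob B, dualizable (U V))
         (dual_comp : forall (V W X : ob B) (M : hom V W) (N : hom W X),
            dualizable M -> dualizable N -> dualizable (M ⊙ N))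
         (L : bicat_on (lambda_cells dual_U dual_comp)),
    (forall (P Q : ob (lambda_cells dual_U dual_comp)) (m : hom P Q),
       mor2 (id2 m) = id2 (mor1 m))
    /\ (forall (P Q : ob (lambda_cells dual_U dual_comp)) (m n p : hom P Q)
          (f : m ⇒ n) (g : n ⇒ p),
       mor2 (g ∘ f) = mor2 g ∘ mor2 f)
    /\ (forall (P Q T : ob (lambda_cells dual_U dual_comp))
          (m m' : hom P Q) (n n' : hom Q T) (f : m ⇒ m') (g : n ⇒ n'),
       mor2 (f ⊙₂ g) = mor2 f ⊙₂ mor2 g)
    /\ (forall (P Q T S : ob (lambda_cells dual_U dual_comp))
          (m : hom P Q) (n : hom Q T) (p : hom T S),
       mor2 (assoc m n p) = assoc (mor1 m) (mor1 n) (mor1 p))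
    /\ (forall (P Q : ob (lambda_cells dual_U dual_comp)) (m : hom P Q),
       mor2 (lunit m) = lunit (mor1 m))
    /\ (forall (P Q : ob (lambda_cells dual_U dual_comp)) (m : hom P Q),
       mor2 (runit m) = runit (mor1 m)).
Proof.
exists (@dualizable_unit B), (@dualizable_comp B), (@lambda_bicat B).
(* The structure 2-cells lie over those of [B] by transparent definitions, so every clause holds by
   computation. *)
repeat split.
Qed.
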